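(* For every integer $d\ge 4$ and every real $p$ with $0<p<1$, $$D_d(p)>p ,$$ where $D_d(p)$ denotes the infimum, over all invariant edge percolations $S$ on the $d$-regular tree with marginal $p$, of $\operatorname{ess\,sup} D(S)$, with $D(S)$ the supremal density of open edges along infinite self-avoiding paths (all as defined in the context).
   Context: Let $T_d$ be the infinite $d$-regular tree with edge set $E(T_d)$. An invariant percolation on the edges of $T_d$ is a random element $S=(S(e))_{e\in E(T_d)}$ of $\{0,1\}^{E(T_d)}$ whose law is invariant under all automorphisms of $T_d$; an edge $e$ is open if $S(e)=1$. Its marginal is $p=\mathbb{P}(S(e)=1)$, which does not depend on $e$. For an infinite self-avoiding path $\overline{x}=(x_0,x_1,x_2,\dots)$ in $T_d$ (consecutive vertices adjacent, all vertices distinct, arbitrary starting vertex), the density of $S$ along $\overline{x}$ is $$D(\overline{x})=\limsup_{n\to\infty}\frac1n\sum_{k=1}^n S(x_{k-1},x_k),$$ and $D(S)=\sup_{\overline{x}}D(\overline{x})$, the supremum being over all infinite self-avoiding paths; $D(S)$ is a random variable. For $p\in[0,1]$ define $$D_d(p)=\inf_S \operatorname{ess\,sup} D(S),$$ where the infimum is over all invariant percolations $S$ on the edges of $T_d$ with marginal $p$. *)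

(* Defs.v *)
From HB Require Import structures.
From mathcomp Require Import all_boot all_order all_algebra.
From mathcomp Require Import finmap.
From mathcomp Require Import zify.
From mathcomp Require Import all_classical all_reals all_analysis ess_sup_inf.
Set Implicit Arguments.
Unset Strict Implicit.
Unset Printing Implicit Defensive.

Import Order.TTheory GRing.Theory Num.Theory.

Section Graph.
Variables (V : countType) (adj : rel V).

Definition is_edge (e : {fset V}) : bool :=
  `[< exists u v, adj u v /\ e = [fset u; v]%fset >].

Definition edge : Type := {e : {fset V} | is_edge e}.

Lemma is_edge_adj u v : adj u v -> is_edge [fset u; v]%fset.
Proof. by move=> uv; apply/asboolP; exists u, v. Qed.

Definition edge_of u v (uv : adj u v) : edge :=
  exist (fun e => is_edge e) [fset u; v]%fset (is_edge_adj uv).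

Record automorphism := Automorphism {
  aut_fun :> V -> V ;
  aut_bij : bijective aut_fun ;
  aut_adj : forall u v, adj (aut_fun u) (aut_fun v) = adj u v }.

Lemma is_edge_image (g : automorphism) (e : edge) :
  is_edge [fset g v | v in val e]%fset.
Proof.
case: e => e /= /asboolP[u [v [uv ->]]]; apply/asboolP.
exists (g u), (g v); split; first by rewrite aut_adj.
by rewrite imfsetU !imfset_fset1.
Qed.

Definition edge_image (g : automorphism) (e : edge) : edge :=
  exist (fun e => is_edge e) [fset g v | v in val e]%fset (is_edge_image g e).

Record ray := Ray {
  ray_fun :> nat -> V ;
  ray_inj : injective ray_fun ;
  ray_adj : forall k, adj (ray_fun k) (ray_fun k.+1) }.

Definition ray_edge (x : ray) (k : nat) : edge := edge_of (ray_adj x k).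

(* [true] stands for "open". *)
Local Open Scope classical_set_scope.
Definition cylinders : set (set (edge -> bool)) :=
  [set A | exists (e : edge) (b : bool), A = [set s | s e = b]].

(* {0,1}^E with its product sigma-algebra *)
Definition config : Type := g_sigma_algebraType cylinders.


Definition config_act (g : automorphism) (s : config) : config :=
  fun e => s (edge_image g e).

Local Open Scope ring_scope.
Local Open Scope ereal_scope.
Variable R : realType.

(* The n-th average runs over the first n edges of x; the junk value at n = 0
   does not affect the limsup. *)
Definition density (s : config) (x : ray) : \bar R :=
  limn_esup (fun n => (n%:R^-1 * \sum_(k < n) (s (ray_edge x k))%:R)%R%:E).

Definition sup_density (s : config) : \bar R := ereal_sup (range (density s)).

Definition invariant_law disp (Omega : measurableType disp)
    (P : probability Omega R) (S : {RV P >-> config}) : Prop :=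
  forall (g : automorphism) (A : set config), measurable A ->
    distribution P S (config_act g @^-1` A) = distribution P S A.

Definition has_marginal disp (Omega : measurableType disp)
    (P : probability Omega R) (S : {RV P >-> config}) (p : R) : Prop :=
  forall e : edge, P [set w | S w e = true] = p%:E.

(* [ess_sup] is defined through negligible sets, which need not be measurable,
   so it makes sense although [sup_density] is a supremum over uncountably many
   rays. *)
Definition inf_ess_sup_density (p : R) : \bar R :=
  ereal_inf [set y | exists disp (Omega : measurableType disp)
      (P : probability Omega R) (S : {RV P >-> config}),
    [/\ invariant_law S, has_marginal S p &
        y = ess_sup P (fun w => sup_density (S w))]].

End Graph.

Definition regular_tree (d : nat) (V : countType) (adj : rel V) : Prop :=
  [/\ symmetric adj /\ irreflexive adj,
      forall u, exists s : seq V, [/\ uniq s, size s = d & s =i adj u],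
      forall u v, exists s, path adj u s /\ last u s = v &
      forall s, (2 < size s)%N -> ~~ ucycleb adj s].

(* The d-regular tree, as the Cayley graph of the free product of d copies of
   Z/2: vertices are the words over d letters without two equal consecutive
   letters, and two words are adjacent when one is obtained from the other by
   prepending a letter. *)
Section Tree.
Variable d : nat.

Definition reduced (w : seq 'I_d) : bool := sorted (fun i j => i != j) w.

Definition tree_vertex : Type := {w : seq 'I_d | reduced w}.
HB.instance Definition _ := SubCountable.on tree_vertex.

Definition tree_child (u v : tree_vertex) : bool :=
  [exists i : 'I_d, val v == i :: val u].

Definition tree_adj : rel tree_vertex :=
  fun u v => tree_child u v || tree_child v u.

Lemma tree_childP u v :
  reflect (exists i, val v = i :: val u) (tree_child u v).
Proof. by apply: (iffP existsP) => -[i /eqP]; exists i => //; apply/eqP. Qed.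

Lemma tree_adj_sym : symmetric tree_adj.
Proof. by move=> u v; rewrite /tree_adj orbC. Qed.

Lemma tree_adj_irr : irreflexive tree_adj.
Proof.
move=> u; apply/negP; rewrite /tree_adj orbb => /tree_childP[i].
by move/(congr1 size) => /= /n_Sn.
Qed.

Lemma tree_parent_unique u v w : tree_adj u v -> tree_adj u w ->
  (size (val v) <= size (val u))%N -> (size (val w) <= size (val u))%N -> v = w.
Proof.
case/orP=> /tree_childP[i ei]; first by rewrite ei /= ltnn.
case/orP=> /tree_childP[j ej]; first by rewrite ej /= ltnn.
by move=> _ _; apply: val_inj; move: ej; rewrite ei => -[].
Qed.

Lemma tree_degree u :
  exists s : seq tree_vertex, [/\ uniq s, size s = d & s =i tree_adj u].
Proof.
pose nb (i : 'I_d) : seq 'I_d :=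
  if val u is j :: w then if i == j then w else i :: val u else [:: i].
have nb_red i : reduced (nb i).
  have := valP u; rewrite /nb; case: (val u) => [//|j w] rw.
  case: eqP => [_|/eqP ij]; first exact: path_sorted rw.
  by rewrite /reduced /= ij.
pose f i : tree_vertex := exist (fun w => reduced w) (nb i) (nb_red i).
have nb_inj : injective nb.
  move=> i k; rewrite /nb; case: (val u) => [[]|j w] //.
  case: eqP => [->|_]; case: eqP => [->|_] //.
  - by move/(congr1 size) => /=; lia.
  - by move/(congr1 size) => /=; lia.
  - by case.
exists [seq f i | i <- enum 'I_d]; split.
- by rewrite map_inj_uniq ?enum_uniq // => i k [] /nb_inj.
- by rewrite size_map size_enum_ord.
move=> v; apply/mapP/orP => [[i _ ->]|].
  rewrite /tree_child /f /nb /=; case: (val u) => [|j w].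
    by left; apply/existsP; exists i.
  case: (i =P j) => [_|_]; [right|left]; apply/existsP; first by exists j.
  by exists i.
case=> /tree_childP[i e]; exists i; rewrite ?mem_enum //; apply: val_inj; change (val v = nb i).
  have := valP v; rewrite e /nb; case: (val u) => [//|j w].
  by case/andP => /negPf ->.
by rewrite /nb e eqxx.
Qed.

Lemma tree_path_root u : exists s, path tree_adj u s /\ val (last u s) = [::].
Proof.
case: u => w; elim: w => [|i w IHw] rw; first by exists [::].
have rw' : reduced w by exact: path_sorted rw.
have [s [ps ls]] := IHw rw'.
exists (exist (fun w => reduced w) w rw' :: s); split => //=.
by rewrite ps andbT; apply/orP; right; apply/tree_childP; exists i.
Qed.

Lemma tree_connected u v : exists s, path tree_adj u s /\ last u s = v.
Proof.
have [s [ps ls]] := tree_path_root u.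
have [t [pt lt]] := tree_path_root v.
have lst : last u s = last v t by apply: val_inj; rewrite ls lt.
exists (s ++ rev (belast v t)); split; last first.
  case: t {pt lt} lst => [|x t _]; first by rewrite cats0.
  by rewrite /= rev_cons last_cat last_rcons.
rewrite cat_path ps lst rev_path.
by rewrite (eq_path (e' := tree_adj)) // => x y; rewrite tree_adj_sym.
Qed.

Lemma tree_acyclic s : (2 < size s)%N -> ~~ ucycleb tree_adj s.
Proof.
move=> s2; apply/negP => /andP[cs us].
have [u us_in umax] : exists2 u, u \in s &
    forall v, v \in s -> (size (val v) <= size (val u))%N.
  case: s s2 {cs us} => [//|a s _].
  elim: s a => [|b s IHs] a.
    by exists a; rewrite ?mem_head // => v; rewrite inE => /eqP ->.
  have [u us umax] := IHs b.
  have [au|/ltnW ua] := leqP (size (val a)) (size (val u)).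
    exists u; first by rewrite inE us orbT.
    by move=> v; rewrite inE => /predU1P[->|/umax].
  exists a; first exact: mem_head.
  by move=> v; rewrite inE => /predU1P[-> //|/umax /leq_trans]; apply.
have [i s' rs] := rot_to us_in.
have {}umax v : v \in u :: s' -> (size (val v) <= size (val u))%N.
  by rewrite -rs mem_rot; exact: umax.
move: cs us s2; rewrite -(rot_cycle i) -(rot_uniq i) -(size_rot i) rs.
case: s' {rs} umax => [//|b t]; case/lastP: t => [//|t c] umax.
rewrite /= rcons_path last_rcons => /and3P[ub _ cu].
move=> /and3P[_ bs _] _; case/negP: bs.
rewrite (@tree_parent_unique u b c) //.
- by rewrite mem_rcons mem_head.
- by rewrite tree_adj_sym.
- by apply: umax; rewrite !inE eqxx orbT.
- by apply: umax; rewrite !inE mem_rcons mem_head !orbT.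
Qed.

Lemma tree_regular : regular_tree d tree_adj.
Proof.
split; [by split; [exact: tree_adj_sym | exact: tree_adj_irr]| | |].
- exact: tree_degree.
- exact: tree_connected.
- exact: tree_acyclic.
Qed.
End Tree.

(* Main.v *)
Require Import Defs.
From mathcomp Require Import all_boot all_order all_algebra.
From mathcomp Require Import finmap ring lra.
From mathcomp Require Import all_classical all_reals all_analysis ess_sup_inf.
Set Implicit Arguments.
Unset Strict Implicit.
Unset Printing Implicit Defensive.
Import Order.TTheory GRing.Theory Num.Theory.
Import numFieldNormedType.Exports measurable_realfun.
Local Open Scope classical_set_scope.
Local Open Scope ring_scope.

(** Walk on the tree without backtracking, but with a preference for open edges
that keeps the walk stationary. Suppose that an equivariant weight f(e) > 0 of
the edges splits at every vertex v as f(e) = sum of F(e, e') over the edges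
e' <> e at v, with F nonnegative and symmetric. Take the first edge with weight
f, and step from e to e' with probability F(e, e') / f(e). Mass arriving on an
edge then has weight f again, so each edge of the walk is open with the same
probability E[f S] / E[f], and this exceeds p as soon as f and S are positively
correlated. With N the number of open edges at v, one may take
  F(e, e') = d - N + (d - 1) (S(e) + S(e')),  f(e) = (d - 1) (d + (d - 2) S(e)),
for which the walk meets open edges with frequency
  Q = 2 (d - 1) p / (d + (d - 2) p),  Q - p = (d - 2) p (1 - p) / (d + (d - 2) p).
Here Q > p does not depend on S, so it is enough to show that D(S) is almost
surely less than M only if Q <= M (lemma [ae_density_lt]).

The walk is run for finitely many steps only. If all infinite paths have density less than M, then by compactness
([above_ray]) there is a length L, depending on the starting edge, such that
every path of length L has a nonempty prefix with average at most M. As in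
the proof of the ergodic theorem by Katznelson and Weiss, a long path is cut
into such prefixes and into single edges where a given L is too short
([payoff_reward_le]); hence the number of open edges on a path of length n is at
most M n + L plus the number of those exceptional edges. By stationarity
([mean_mass_value]) the mean of this inequality, divided by n, gives Q <= M plus
a multiple of the probability that L is too short, which vanishes as L grows
([stationary_density_le]).

On words, prepending letters moves along the tree and appending a letter is an
automorphism. A path from the empty word is thus a sequence of letters, any two
consecutive ones distinct, and [shift i] gives the configuration seen after the
step along the edge i. The argument is carried out for any measure-preserving
maps [tau i] in place of the shifts, and any functions [s i] with
[s i (tau i x) = s i x] in place of the states of the edges at the root: crossing
an edge does not change its state. *)

(** * The biased walk and its payoff along finite paths *)

Section Walk.
Variables (R : realType) (d : nat) (T : Type).
Variables (tau : 'I_d -> T -> T) (s : 'I_d -> T -> bool).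
Hypothesis d_gt1 : (1 < d)%N.
Hypothesis s_tau : forall i x, s i (tau i x) = s i x.

Local Notation D := (d%:R : R).

Let D2 : 2 <= D. Proof. by rewrite (ler_nat R 2 d). Qed.

(** The negative term makes the sum over [j != i] depend on [s i] alone, see
[sum_flow], and the constant [D] then keeps the flow nonnegative. Scaling by
[D - 1] avoids a division. *)
Definition flow (i j : 'I_d) (x : T) : R :=
  D - \sum_k (s k x)%:R + (D - 1) * ((s i x)%:R + (s j x)%:R).

Definition mass (i : 'I_d) (x : T) : R := (D - 1) * (D + (D - 2) * (s i x)%:R).

Lemma flow_ge0 i j x : 0 <= flow i j x.
Proof.
apply: addr_ge0; last by apply: mulr_ge0; [by have := D2; lra | exact: addr_ge0].
rewrite subr_ge0; apply: le_trans (_ : \sum_(k < d) 1 <= _).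
  by apply: ler_sum => k _; case: (s k x).
by rewrite sumr_const card_ord.
Qed.

Lemma flow_sym i j x : flow i j x = flow j i x.
Proof. by rewrite /flow [(s i x)%:R + _]addrC. Qed.

Lemma sum_flow i x : \sum_(j | j != i) flow i j x = mass i x.
Proof.
have E (f : 'I_d -> R) : \sum_(j | j != i) f j = \sum_j f j - f i.
  by rewrite [in RHS](bigD1 i) //= addrAC subrr add0r.
rewrite E /flow !big_split /= -mulr_sumr big_split /= !sumr_const !card_ord /mass.
rewrite -[D *+ d]mulr_natr -[(- _) *+ d]mulr_natr -[(s i x)%:R *+ d]mulr_natr.
by set N := \sum_k _; case: (s i x) => /=; ring.
Qed.

Lemma mass_gt0 i x : 0 < mass i x.
Proof.
by rewrite /mass; case: (s i x) => /=; rewrite ?mulr1 ?mulr0 mulr_gt0 //;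
  have := D2; lra.
Qed.

Section Value.
Variable h : 'I_d -> T -> R.

(** The expected total of [h] over the first [n] edges of the biased walk whose
first edge is [i]. The transition after [i] is decided at the far end of that
edge, where the configuration is [tau i x]. *)
Fixpoint value n i x : R :=
  if n is m.+1 then
    h i x + \sum_(j | j != i) flow i j (tau i x) / mass i x * value m j (tau i x)
  else 0.

Fixpoint payoff (t : seq 'I_d) x : R :=
  if t is i :: t' then h i x + payoff t' (tau i x) else 0.

(** The transition probabilities out of an edge sum to 1 by [sum_flow], because
[tau i] leaves [s i], hence [mass i], unchanged. So an expectation over paths is
at most the maximum over paths. *)
Lemma value_le_payoff n c i x :
  (forall t, size t = n -> reduced (i :: t) -> payoff (i :: t) x <= c) ->
  value n.+1 i x <= c.
Proof.
elim: n c i x => [|n IHn] c i x hc.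
  have := hc [::] erefl erefl; rewrite /= addr0.
  by rewrite big1 ?addr0 // => j _; rewrite mulr0.
rewrite -[value _ _ _]/(_ + _) -lerBrDl.
have w_ge0 j : 0 <= flow i j (tau i x) / mass i x.
  by rewrite mulr_ge0 ?flow_ge0 // invr_ge0 ltW ?mass_gt0.
have -> : c - h i x = \sum_(j | j != i) flow i j (tau i x) / mass i x * (c - h i x).
  rewrite -mulr_suml -mulr_suml sum_flow /mass s_tau -/(mass i x).
  by rewrite divff ?mul1r // gt_eqF ?mass_gt0.
apply: ler_sum => j ji; rewrite ler_wpM2l // IHn // => t st rt.
rewrite lerBrDl; apply: (hc (j :: t)); first by rewrite /= st.
by rewrite /reduced /= eq_sym ji.
Qed.

Lemma payoff_cat t1 t2 x :
  payoff (t1 ++ t2) x = payoff t1 x + payoff t2 (foldl (fun y i => tau i y) x t1).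
Proof. by elim: t1 x => [|i t IHt] x /=; rewrite ?add0r // IHt addrA. Qed.
End Value.

Lemma ler_payoff (h1 h2 : 'I_d -> T -> R) t x :
  (forall i y, h1 i y <= h2 i y) -> payoff h1 t x <= payoff h2 t x.
Proof. by move=> h12; elim: t x => [|i t IHt] x //=; rewrite lerD. Qed.

Variable M : R.

Definition gain i x : R := (s i x)%:R - M.

(** Some path of length [L] that starts with [i] keeps all its partial sums of
[gain], counted from the initial capital [c], positive. *)
Fixpoint above L i c x : bool :=
  if L is m.+1 then
    (0 < c + gain i x) && [exists j, (j != i) && above m j (c + gain i x) (tau i x)]
  else true.

Lemma aboveW L i c x : above L.+1 i c x -> above L i c x.
Proof.
elim: L i c x => [//|L IHL] i c x /andP[c0 /existsP[j /andP[ji aj]]].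
by apply/andP; split=> //; apply/existsP; exists j; rewrite ji; apply: IHL.
Qed.

Lemma above_le L K i c x : (L <= K)%N -> above K i c x -> above L i c x.
Proof. by move=> /subnK <-; elim: (K - L)%N => // n IHn; rewrite addSn => /aboveW. Qed.

Lemma not_above_prefix L i t c x : (L <= size t)%N -> reduced (i :: t) ->
  ~~ above L i c x ->
  exists t1 t2, i :: t = (i :: t1) ++ t2 /\ c + payoff gain (i :: t1) x <= 0.
Proof.
elim: L i t c x => [//|L IHL] i [//|j t] c x Lt rt.
rewrite /= negb_and => /orP[c0|].
  by exists [::], (j :: t); split => //=; rewrite addr0 leNgt.
move/existsPn/(_ j); have ji : j != i by move: rt => /andP[]; rewrite eq_sym.
rewrite ji /= => /(IHL _ t); case=> //.
  by move: rt => /andP[].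
by move=> t1 [t2 [-> le0]]; exists (j :: t1), t2; rewrite /= addrA.
Qed.

(** The indicator subtracted here makes the reward nonpositive at those edges
from which [L] steps may not suffice to bring the average down to [M]. *)
Definition reward L i x : R := gain i x - (above L i 0 x)%:R.

(** Read the path from left to right. An edge with [above] set contributes at
most [1 - M - 1 <= 0]; from any other edge, either at most [L] edges remain and
each contributes at most 1, or [not_above_prefix] gives a block of
nonpositive total, after which the argument starts afresh. *)
Lemma payoff_reward_le L t x : 0 <= M -> reduced t ->
  payoff (reward L) t x <= L%:R.
Proof.
move=> M0; have [n] := ubnP (size t).
elim: n t x => // n IHn [|i t] x //=.
rewrite ltnS => tn rt.
have gle1 j y : gain j y <= 1 by rewrite /gain; case: (s j y) => /=; lra.
have [|nab] := boolP (above L i 0 x).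
  move=> ab; rewrite -[leRHS]add0r lerD ?IHn //; last exact: path_sorted rt.
  by rewrite /reward ab /=; have := gle1 i x; lra.
have [tL|Lt] := ltnP (size t) L; last first.
  have [t1 [t2 [et le0]]] := not_above_prefix Lt rt nab.
  rewrite -[leLHS]/(payoff _ (i :: t) x) et payoff_cat -[leRHS]add0r lerD //.
    move: le0; rewrite add0r; apply: le_trans; apply: ler_payoff => j y.
    by rewrite /reward; case: above => /=; lra.
  apply: IHn.
    move/(congr1 size): et tn => /= [->]; rewrite size_cat.
    by apply: leq_ltn_trans; rewrite leq_addl.
  by have := rt : reduced (i :: t); rewrite et /reduced => /cat_sorted2[].
have : payoff (reward L) (i :: t) x <= (size (i :: t))%:R.
  elim: (i :: t) x {IHn nab rt tn tL} => [|j u IHu] y //=.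
  rewrite mulrS lerD //.
  by apply: le_trans (gle1 j y); rewrite /reward; case: above => /=; lra.
by move=> /le_trans; apply; rewrite ler_nat.
Qed.

Lemma value_reward_le L n i x : 0 <= M -> value (reward L) n i x <= L%:R.
Proof.
move=> M0; case: n => [|n]; first exact: ler0n.
by apply: value_le_payoff => t _ rt; exact: payoff_reward_le.
Qed.

(** Pigeonhole over the finitely many letters: if each continuation [j] died at
some length, none would survive beyond the largest of these lengths. *)
Lemma above_step i c x : (forall L, above L i c x) ->
  0 < c + gain i x /\
  exists2 j, j != i & forall L, above L j (c + gain i x) (tau i x).
Proof.
move=> ab; split; first by have /andP[] := ab 1%N.
apply: contrapT => no.
have K j : {L | j != i -> ~~ above L j (c + gain i x) (tau i x)}.
  apply: cid; apply: contrapT => nL; apply: no; exists j.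
    by apply: contrapT => /negP ji; apply: nL; exists 0%N => /idP; rewrite (negPf ji).
  by move=> L; apply: contrapT => /negP nab; apply: nL; exists L.
have /andP[_ /existsP[j /andP[ji]]] := ab (\max_j sval (K j)).+1.
by move=> /(above_le (leq_bigmax j)); apply/negP; exact: svalP (K j) ji.
Qed.

(** Koenig's lemma: iterate [above_step]. *)
Lemma above_ray i x : (forall L, above L i 0 x) ->
  exists a : nat -> 'I_d, (forall k, a k.+1 != a k) /\
    forall n, 0 < payoff gain (mkseq a n.+1) x.
Proof.
move=> ab.
(* A state records the next letter, the capital and the configuration. *)
pose inv q := forall L, above L q.1.1 q.1.2 q.2.
pose next (q : 'I_d * R * T) (j : 'I_d) := (j, q.1.2 + gain q.1.1 q.2, tau q.1.1 q.2).
have step (q : {q | inv q}) : {q' : {q | inv q} |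
    exists2 j, j != (sval q).1.1 & sval q' = next (sval q) j}.
  case: q => -[[j c] y] q; apply: cid; have [_ [k kj abk]] := above_step q.
  by exists (exist inv (next (j, c, y) k) abk); exists k.
pose sg := fix sg n : {q | inv q} :=
  if n is m.+1 then sval (step (sg m)) else exist inv (i, 0, x) ab.
pose a n := (sval (sg n)).1.1.
have sgS n : sval (sg n.+1) = next (sval (sg n)) (a n.+1) /\ a n.+1 != a n.
  rewrite /a /=; case: (step (sg n)) => q' /= [j ji ->].
  by [].
exists a; split=> [k|n]; first by have [] := sgS k.
have walk m : (sval (sg m)).2 = foldl (fun y i => tau i y) x (mkseq a m) /\
    (sval (sg m)).1.2 = payoff gain (mkseq a m) x.
  elim: m => [//|m [IH1 IH2]]; have [-> _] := sgS m.
  by rewrite mkseqS -cats1 foldl_cat payoff_cat -IH2 -IH1 /= addr0.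
have := svalP (sg n) => /above_step[+ _].
by rewrite mkseqS -cats1 payoff_cat (walk n).1 (walk n).2 /= addr0.
Qed.
End Walk.

(** * Means of bounded measurable functions *)

Section BoundedMeasurable.
Variables (R : realType) (disp : measure_display) (T : measurableType disp).

(** Unlike integrability, this is stable under products. *)
Definition bounded_measurable (f : T -> R) : Prop :=
  measurable_fun setT f /\ exists K, forall x, `|f x| <= K.

Lemma bounded_measurable_cst c : bounded_measurable (fun=> c).
Proof. by split; [exact: measurable_cst | exists `|c|]. Qed.

Lemma bounded_measurableD f g : bounded_measurable f -> bounded_measurable g ->
  bounded_measurable (fun x => f x + g x).
Proof.
move=> [mf [K fK]] [mg [L gL]]; split; first exact: measurable_funD.
by exists (K + L) => x; rewrite (le_trans (ler_normD _ _)) // lerD.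
Qed.

Lemma bounded_measurableM f g : bounded_measurable f -> bounded_measurable g ->
  bounded_measurable (fun x => f x * g x).
Proof.
move=> [mf [K fK]] [mg [L gL]]; split; first exact: measurable_funM.
by exists (K * L) => x; rewrite normrM ler_pM.
Qed.

Lemma bounded_measurableN f : bounded_measurable f ->
  bounded_measurable (fun x => - f x).
Proof.
by move=> [mf [K fK]]; split; [exact: measurable_funN | exists K => x; rewrite normrN].
Qed.

Lemma bounded_measurableB f g : bounded_measurable f -> bounded_measurable g ->
  bounded_measurable (fun x => f x - g x).
Proof. by move=> bf bg; apply: bounded_measurableD => //; exact: bounded_measurableN. Qed.

Lemma bounded_measurable_sum (I : Type) (r : seq I) (P : pred I) (f : I -> T -> R) :
  (forall i, bounded_measurable (f i)) ->
  bounded_measurable (fun x => \sum_(i <- r | P i) f i x).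
Proof.
move=> bf; elim: r => [|i r IHr].
  by under eq_fun do rewrite big_nil; exact: bounded_measurable_cst.
under eq_fun do rewrite big_cons.
by case: (P i) => //; exact: bounded_measurableD.
Qed.

Lemma bounded_measurable_bool (b : T -> bool) : measurable_fun setT b ->
  bounded_measurable (fun x => (b x)%:R).
Proof.
move=> mb; split; last by exists 1 => x; case: (b x); rewrite ?normr1 ?normr0.
rewrite (_ : (fun x => _) = fun x => if b x then 1 else 0).
  by apply: measurable_fun_ifT => //; exact: measurable_cst.
by apply/funext => x; case: (b x).
Qed.

Lemma bounded_measurable_comp (phi : T -> T) f : measurable_fun setT phi ->
  bounded_measurable f -> bounded_measurable (f \o phi).
Proof.
by move=> mphi [mf [K fK]]; split; [exact: measurableT_comp | exists K => x; exact: fK].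
Qed.

Variable mu : probability T R.

Lemma bounded_measurable_integrable f : bounded_measurable f ->
  mu.-integrable setT (EFin \o f).
Proof.
move=> [mf [K fK]]; apply: measurable_bounded_integrable => //.
  by rewrite (le_lt_trans (probability_le1 _ _)) ?ltry.
exists K; split=> [|M KM x _ /=]; first exact: num_real.
exact: le_trans (fK x) (ltW KM).
Qed.

Local Notation E f := (\int[mu]_x f x).

Lemma mean_cst c : E (fun=> c) = c.
Proof.
rewrite Rintegral_cst // -[RHS]mulr1; congr (c * _).
exact: (congr1 fine (probability_setT mu)).
Qed.

Lemma meanD f g : bounded_measurable f -> bounded_measurable g ->
  E (fun x => f x + g x) = E f + E g.
Proof. by move=> bf bg; rewrite RintegralD //; exact: bounded_measurable_integrable. Qed.

Lemma meanZl c f : bounded_measurable f -> E (fun x => c * f x) = c * E f.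
Proof. by move=> bf; rewrite RintegralZl //; exact: bounded_measurable_integrable. Qed.

Lemma le_mean f g : bounded_measurable f -> bounded_measurable g ->
  (forall x, f x <= g x) -> E f <= E g.
Proof.
by move=> bf bg fg; apply: le_Rintegral => //; exact: bounded_measurable_integrable.
Qed.

Lemma mean_sum (I : Type) (r : seq I) (P : pred I) (f : I -> T -> R) :
  (forall i, bounded_measurable (f i)) ->
  E (fun x => \sum_(i <- r | P i) f i x) = \sum_(i <- r | P i) E (f i).
Proof.
move=> bf; elim: r => [|i r IHr].
  by rewrite big_nil; under eq_Rintegral do rewrite big_nil; exact: mean_cst.
rewrite big_cons; under eq_Rintegral do rewrite big_cons.
by case: (P i) => //; rewrite meanD ?IHr //; exact: bounded_measurable_sum.
Qed.

Lemma mean_bool (b : T -> bool) : measurable_fun setT b ->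
  E (fun x => (b x)%:R) = fine (mu [set x | b x]).
Proof.
move=> mb; have mA : measurable [set x | b x].
  by have := mb measurableT [set true] I; rewrite setTI.
rewrite /Rintegral -(setIT [set x | b x]) -integral_indic //.
congr fine; apply: eq_integral => x _; rewrite indicE.
congr ((nat_of_bool _)%:R%:E); have [bx|nbx] := boolP (b x).
  by apply/esym/mem_set.
by apply/esym/negbTE; rewrite notin_setE; exact/negP.
Qed.

Lemma mean_comp (phi : T -> T) f : measurable_fun setT phi ->
  (forall A, measurable A -> mu (phi @^-1` A) = mu A) ->
  bounded_measurable f -> E (f \o phi) = E f.
Proof.
move=> mphi muphi bf; rewrite /Rintegral; congr fine.
have := @integral_pushforward _ _ _ _ _ _ mphi mu setT (EFin \o f).
rewrite preimage_setT => <- //.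
- by apply: eq_measure_integral => A mA _; exact: muphi.
- by apply: measurableT_comp => //; case: bf.
- exact: bounded_measurable_integrable (bounded_measurable_comp mphi bf).
Qed.
End BoundedMeasurable.

(** * Stationarity of the biased walk *)

Section StationaryWalk.
Variables (R : realType) (d : nat) (disp : measure_display).
Variables (T : measurableType disp) (mu : probability T R).
Variables (tau : 'I_d -> T -> T) (s : 'I_d -> T -> bool) (p : R).
Hypothesis d_gt1 : (1 < d)%N.
Hypothesis s_tau : forall i x, s i (tau i x) = s i x.
Hypothesis measurable_tau : forall i, measurable_fun setT (tau i).
Hypothesis measurable_s : forall i, measurable_fun setT (s i).
Hypothesis mu_tau : forall i A, measurable A -> mu (tau i @^-1` A) = mu A.
Hypothesis mu_s : forall i, mu [set x | s i x] = p%:E.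

Local Notation E f := (\int[mu]_x f x).
Local Notation D := (d%:R : R).

Let bm_s i : bounded_measurable (fun x => (s i x)%:R : R).
Proof. exact: bounded_measurable_bool. Qed.

Lemma bounded_measurable_flow i j : bounded_measurable (flow R s i j).
Proof.
apply: bounded_measurableD.
  apply: bounded_measurableB; first exact: bounded_measurable_cst.
  exact: bounded_measurable_sum.
apply: bounded_measurableM; first exact: bounded_measurable_cst.
exact: bounded_measurableD.
Qed.

Lemma bounded_measurable_mass i : bounded_measurable (mass R s i).
Proof.
do 2![apply: bounded_measurableM; first exact: bounded_measurable_cst
     |apply: bounded_measurableD; first exact: bounded_measurable_cst].
apply: bounded_measurableM; first exact: bounded_measurable_cst.
exact: bm_s.
Qed.

(** As [s i] takes two values, the inverse is an affine function of it. *)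
Lemma bounded_measurable_invmass i : bounded_measurable (fun x => (mass R s i x)^-1).
Proof.
rewrite (_ : (fun x => _) = fun x => ((D - 1) * D)^-1 +
    (((D - 1) * (D + (D - 2)))^-1 - ((D - 1) * D)^-1) * (s i x)%:R).
  apply: bounded_measurableD; first exact: bounded_measurable_cst.
  apply: bounded_measurableM; first exact: bounded_measurable_cst.
  exact: bm_s.
apply/funext => x; rewrite /mass; case: (s i x) => /=.
  by rewrite !mulr1 [RHS]addrC subrK.
by rewrite !mulr0 !addr0.
Qed.

Section Value.
Variable h : 'I_d -> T -> R.
Hypothesis bm_h : forall i, bounded_measurable (h i).

Lemma bounded_measurable_value n i : bounded_measurable (value tau s h n i).
Proof.
elim: n i => [|n IHn] i /=; first exact: bounded_measurable_cst.
apply: bounded_measurableD => //; apply: bounded_measurable_sum => j.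
apply: bounded_measurableM; last exact: (bounded_measurable_comp _ (IHn j)).
apply: bounded_measurableM; last exact: bounded_measurable_invmass.
exact: (bounded_measurable_comp _ (bounded_measurable_flow i j)).
Qed.

(** The mass transport behind stationarity. The factor [mass i] cancels the
denominator of the transition probabilities, invariance under [tau i] moves the
remaining flow from the far end of the edge [i] back to the root, and by the
symmetry of [flow] the mass flowing into the edge [j] sums to [mass j]. *)
Lemma mean_mass_value n :
  \sum_i E (fun x => mass R s i x * value tau s h n i x) =
  n%:R * \sum_i E (fun x => mass R s i x * h i x).
Proof.
elim: n => [|n IHn].
  rewrite mul0r big1 // => i _ /=.
  by under eq_Rintegral do rewrite mulr0; exact: mean_cst.
have bm_fv i j : bounded_measurable (fun x => flow R s i j x * value tau s h n j x).
  apply: bounded_measurableM; first exact: bounded_measurable_flow.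
  exact: bounded_measurable_value.
have step i : E (fun x => mass R s i x * value tau s h n.+1 i x) =
    E (fun x => mass R s i x * h i x) +
    \sum_(j | j != i) E (fun x => flow R s i j x * value tau s h n j x).
  under [X in _ = _ + X]eq_bigr => j _ do
    rewrite -(mean_comp (@measurable_tau i) (@mu_tau i) (bm_fv i j)).
  have bm_fvt j := bounded_measurable_comp (@measurable_tau i) (bm_fv i j).
  rewrite -mean_sum // -meanD; last exact: (bounded_measurable_sum _ _ bm_fvt).
    apply: eq_Rintegral => x _ /=; rewrite mulrDr mulr_sumr; congr (_ + _).
    apply: eq_bigr => j _; rewrite mulrA [_ * (_ / _)]mulrC divfK //.
    by rewrite gt_eqF // mass_gt0.
  by apply: bounded_measurableM => //; exact: bounded_measurable_mass.
under eq_bigr do rewrite step.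
rewrite big_split /= mulrSr mulrDl mul1r addrC -IHn; congr (_ + _).
rewrite (exchange_big_dep xpredT) //=; apply: eq_bigr => j _.
rewrite -mean_sum //; apply: eq_Rintegral => x _.
rewrite -mulr_suml; congr (_ * _); rewrite -sum_flow.
by apply: eq_big => [i|i _]; [rewrite eq_sym | exact: flow_sym].
Qed.

(** The mean total grows linearly in [n] by [mean_mass_value], so it can stay
bounded only with nonpositive slope. *)
Lemma mean_mass_le0 (c : R) : (forall n i x, value tau s h n i x <= c) ->
  \sum_i E (fun x => mass R s i x * h i x) <= 0.
Proof.
move=> hc; set X := \sum_i _; set C := \sum_i E (fun x => mass R s i x * c).
have XC n : n%:R * X <= C.
  rewrite -mean_mass_value; apply: ler_sum => i _; apply: le_mean.
  - apply: bounded_measurableM; first exact: bounded_measurable_mass.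
    exact: bounded_measurable_value.
  - apply: bounded_measurableM; first exact: bounded_measurable_mass.
    exact: bounded_measurable_cst.
  - by move=> x; rewrite ler_wpM2l // ltW // mass_gt0.
rewrite leNgt; apply/negP => X0.
have := XC (Num.bound `|C / X|); apply/negP; rewrite -ltNge -ltr_pdivrMr //.
by rewrite (le_lt_trans (ler_norm _)) // archi_boundP.
Qed.
End Value.

Variable M : R.

Lemma measurable_above L i c : measurable_fun setT (above tau s M L i c).
Proof.
elim: L i c => [|L IHL] i c /=; first exact: measurable_cst.
pose A g x := (0 < c + g) &&
  [exists j, (j != i) && above tau s M L j (c + g) (tau i x)].
rewrite (_ : (fun x => _) = fun x => if s i x then A (1 - M) x else A (0 - M) x).
  have mA g : measurable_fun setT (A g).
    apply: measurable_and; first exact: measurable_cst.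
    rewrite (_ : (fun x => _) = (fun x =>
        has (fun j => (j != i) && above tau s M L j (c + g) (tau i x)) (enum 'I_d))).
      elim: (enum _) => [|j r IHr] /=; first exact: measurable_cst.
      apply: measurable_or => //; apply: measurable_and; first exact: measurable_cst.
      exact: (measurableT_comp (IHL j (c + g))).
    apply/funext => x; apply/existsP/hasP => [[j aj]|[j _ aj]]; exists j => //.
    exact: mem_enum.
  by apply: measurable_fun_ifT.
by apply/funext => x; rewrite /A /gain; case: (s i x).
Qed.

Lemma measurable_above_set L i c : measurable [set x | above tau s M L i c x].
Proof.
by have := @measurable_above L i c measurableT [set true] I; rewrite setTI.
Qed.

Lemma above_forever_bigcap i c :
  [set x | forall L, above tau s M L i c x] =
  \bigcap_L [set x | above tau s M L i c x].
Proof.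
by apply/seteqP; split=> [x xF L _|x xF L]; [exact: xF | exact: xF L Logic.I].
Qed.

Lemma measurable_above_forever i c :
  measurable [set x | forall L, above tau s M L i c x].
Proof.
rewrite above_forever_bigcap; apply: bigcap_measurableType => L _.
exact: measurable_above_set.
Qed.

(** Apply [mean_mass_le0] to [reward L]. Up to the common factor [D (D - 1)], the
means of [mass i * s i] and of [M * mass i] sum to the two sides of the
conclusion. The indicator in [reward L] costs at most the largest mass times the
sum over [i] of the probabilities that [above] holds at length [L], which tends
to 0 by continuity from above. *)
Lemma stationary_density_le : 0 <= M ->
  (forall i, mu [set x | forall L, above tau s M L i 0 x] = 0%E) ->
  2 * (D - 1) * p <= M * (D + (D - 2) * p).
Proof.
move=> M0 null.
have D2 : 2 <= D by rewrite (ler_nat R 2 d).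
have bm_above L i : bounded_measurable (fun x => (above tau s M L i 0 x)%:R : R).
  exact/bounded_measurable_bool/measurable_above.
have bm_reward L i : bounded_measurable (reward tau s M L i).
  apply: bounded_measurableB => //; apply: bounded_measurableB => //.
  exact: bounded_measurable_cst.
pose q i L := fine (mu [set x | above tau s M L i 0 x]).
have cvg_q i : (q i L @[L --> \oo] --> 0)%classic.
  pose F L := [set x | above tau s M L i 0 x]%classic.
  apply: fine_cvg; have -> : 0%:E = mu (\bigcap_L F L).
    by rewrite -[LHS](null i) above_forever_bigcap.
  apply: nonincreasing_cvg_mu.
  - exact: le_lt_trans (probability_le1 mu (measurable_above_set 0 i 0)) (ltry _).
  - by move=> L; exact: measurable_above_set.
  - by rewrite -above_forever_bigcap; exact: measurable_above_forever.
  - move=> n m nm; apply/subsetPset => x; exact: above_le.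
have Es i : E (fun x => (s i x)%:R) = p by rewrite mean_bool // mu_s.
have main L : D * (D - 1) * (2 * (D - 1) * p - M * (D + (D - 2) * p)) <=
    (D - 1) * (D + (D - 2)) * \sum_i q i L.
  have := mean_mass_le0 (bm_reward L)
    (fun n i x => value_reward_le d_gt1 s_tau L n i x M0).
  have lower i : (D - 1) * (2 * (D - 1) * p - M * (D + (D - 2) * p)) -
      (D - 1) * (D + (D - 2)) * q i L <= E (fun x => mass R s i x * reward tau s M L i x).
    (* The reward weighted by [mass i] is bounded below by an affine function of
       the two indicators, using [s i * s i = s i]. *)
    pose c1 := (D - 1) * (2 * (D - 1) - M * (D - 2)).
    pose c2 := (D - 1) * M * D.
    pose c3 := (D - 1) * (D + (D - 2)).
    have bS := bounded_measurableM (bounded_measurable_cst _ c1) (bm_s i).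
    have bA := bounded_measurableM (bounded_measurable_cst _ (- c3)) (bm_above L i).
    have bC := bounded_measurableD (bounded_measurable_cst _ (- c2)) bA.
    have -> : (D - 1) * (2 * (D - 1) * p - M * (D + (D - 2) * p)) - c3 * q i L =
        E (fun x => c1 * (s i x)%:R + (- c2 + - c3 * (above tau s M L i 0 x)%:R)).
      rewrite (meanD mu bS bC) (meanD mu (bounded_measurable_cst _ _) bA) mean_cst.
      rewrite (meanZl mu _ (bm_s i)) (meanZl mu _ (bm_above L i)) Es.
      rewrite (mean_bool mu (measurable_above L i 0)) -/(q i L) /c1 /c2 /c3; ring.
    apply: le_mean.
    - exact: bounded_measurableD.
    - by apply: bounded_measurableM => //; exact: bounded_measurable_mass.
    - move=> x; rewrite /mass /reward /gain /c1 /c2 /c3.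
      case: (s i x); case: above => /=; nra.
  move=> /(le_trans (ler_sum _ (fun i _ => lower i))).
  rewrite big_split /= sumr_const card_ord -[((_ - _) * _) *+ d]mulr_natl.
  rewrite sumrN -mulr_sumr mulrA.
  by rewrite subr_le0.
have lim0 : ((D - 1) * (D + (D - 2)) * \sum_i q i L @[L --> \oo] -->
    (D - 1) * (D + (D - 2)) * \sum_(i < d) 0).
  by apply: cvgMl_tmp; apply: cvg_big => [|i _]; [exact: add_continuous | exact: cvg_q].
suff : D * (D - 1) * (2 * (D - 1) * p - M * (D + (D - 2) * p)) <=
    (D - 1) * (D + (D - 2)) * \sum_(i < d) 0.
  rewrite big1 // mulr0 pmulr_rle0 ?subr_le0 //.
  by apply: mulr_gt0; lra.
by apply: (cvgr_to_ge lim0); exact: nearW.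
Qed.
End StationaryWalk.

(** * Moving the root of the tree *)

Section RightMultiplication.
Variable d : nat.
Implicit Types (i j : 'I_d) (w t : seq 'I_d) (u v : tree_vertex d).

(** Right multiplication by a generator of the free product of copies of Z/2: the
new letter cancels against an equal last letter. *)
Fixpoint append_letter i w : seq 'I_d :=
  if w is j :: w' then
    if (w' == [::]) && (j == i) then [::] else j :: append_letter i w'
  else [:: i].

Lemma append_letter_reduced i w : reduced w -> reduced (append_letter i w).
Proof.
elim: w => [//|j w IHw] /= rw; case: ifPn => // wji.
have := IHw (path_sorted rw); case: w wji rw {IHw} => [/= ji _ _|k w _ /= /andP[jk rw]].
  by rewrite /reduced /= ji.
by case: ifP => //= _ rk; rewrite /reduced /= jk.
Qed.

Lemma append_letterK i w : reduced w -> append_letter i (append_letter i w) = w.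
Proof.
elim: w => [|j w IHw] /= rw; first by rewrite eqxx.
have {}IHw := IHw (path_sorted rw).
case: ifPn => [/andP[/eqP-> /eqP->] //|_ /=].
case: ifPn => [/andP[/eqP w0 /eqP ji]|_]; last by rewrite IHw.
by move: rw; rewrite /reduced -IHw w0 -ji /= eqxx.
Qed.

Lemma append_letter_rcons i w : reduced (rcons w i) -> append_letter i w = rcons w i.
Proof.
elim: w => [//|j w IHw] /= rw; rewrite (IHw (path_sorted rw)).
by case: ifPn rw => // /andP[/eqP-> /eqP->] /=; rewrite eqxx.
Qed.

(** The second case is [w] empty and [j = i], where the edge between the two words
is reversed. *)
Lemma append_letter_cons i j w :
  append_letter i (j :: w) = j :: append_letter i w \/
  append_letter i w = i :: append_letter i (j :: w).
Proof. by rewrite /=; case: ifPn => [/andP[/eqP-> _]|_]; [right | left]. Qed.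

Definition right_mul i u : tree_vertex d :=
  exist (fun w => reduced w) (append_letter i (val u))
    (append_letter_reduced i (valP u)).

Lemma right_mulK i : involutive (right_mul i).
Proof. by move=> u; apply: val_inj; apply: append_letterK (valP u). Qed.

Lemma right_mul_child i u v : tree_child u v ->
  tree_adj (right_mul i u) (right_mul i v).
Proof.
move=> /tree_childP[j vju]; rewrite /tree_adj.
have := append_letter_cons i j (val u); rewrite -vju.
by case=> E; apply/orP; [left | right]; apply/tree_childP; [exists j | exists i].
Qed.

Lemma right_mul_adj i u v :
  tree_adj (right_mul i u) (right_mul i v) = tree_adj u v.
Proof.
have sub a b : tree_adj a b -> tree_adj (right_mul i a) (right_mul i b).
  by case/orP => /(right_mul_child i) //; rewrite tree_adj_sym.
by apply/idP/idP; [move/sub; rewrite !right_mulK | exact: sub].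
Qed.

Definition right_aut i : automorphism (@tree_adj d) :=
  Automorphism (inv_bij (right_mulK i)) (right_mul_adj i).

(** The configuration seen from the neighbour [i] of the root, this neighbour
being taken as the new root. *)
Definition shift i (S : config (@tree_adj d)) : config (@tree_adj d) :=
  config_act (right_aut i) S.

Lemma right_mul_foldr v t : reduced (val v ++ rev t) ->
  val (foldr right_mul v t) = val v ++ rev t.
Proof.
elim: t => [|i t IHt] /=; first by rewrite cats0.
rewrite rev_cons -rcons_cat => rvt.
rewrite IHt; first exact: append_letter_rcons.
by move: rvt; rewrite -cats1 => /cat_sorted2[].
Qed.

Lemma edge_image_foldr u v (uv : tree_adj u v) t :
  val (foldr (fun i => edge_image (right_aut i)) (edge_of uv) t) =
  [fset foldr right_mul u t; foldr right_mul v t]%fset.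
Proof.
elim: t => [//|i t IHt] /=.
by rewrite [X in (_ @` X)%fset]IHt imfsetU !imfset_fset1.
Qed.

(** The shifts compose in the order opposite to the automorphisms, as they act on
functions of the edges. *)
Lemma foldl_shift S t e :
  foldl (fun S i => shift i S) S t e =
  S (foldr (fun i => edge_image (right_aut i)) e t).
Proof. by elim: t S => [//|i t IHt] S /=; rewrite IHt. Qed.

Definition root : tree_vertex d := exist (fun w => reduced w) [::] isT.

Definition letter i : tree_vertex d := exist (fun w => reduced w) [:: i] isT.

Lemma root_letter i : tree_adj root (letter i).
Proof. by apply/orP; left; apply/tree_childP; exists i. Qed.

Definition root_open i (S : config (@tree_adj d)) : bool := S (edge_of (root_letter i)).

(** The automorphism exchanges the two ends of the edge between the root and
[i]. *)
Lemma root_open_shift i S : root_open i (shift i S) = root_open i S.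
Proof.
congr S; apply: val_inj; apply: etrans (edge_image_foldr (root_letter i) [:: i]) _.
have -> : foldr right_mul root [:: i] = letter i by exact: val_inj.
have -> : foldr right_mul (letter i) [:: i] = root.
  by apply: val_inj; rewrite /= eqxx.
exact: fsetUC.
Qed.

Section WordRay.
Variable a : nat -> 'I_d.
Hypothesis aS : forall k, a k.+1 != a k.

Lemma reduced_rev_mkseq k : reduced (rev (mkseq a k)).
Proof.
elim: k => [//|k IHk]; rewrite mkseqS rev_rcons; case: k IHk => [//|k].
by rewrite mkseqS rev_rcons /reduced /= => ->; rewrite aS.
Qed.

Definition word_vertex k : tree_vertex d :=
  exist (fun w => reduced w) (rev (mkseq a k)) (reduced_rev_mkseq k).

Lemma word_vertex_inj : injective word_vertex.
Proof. by move=> k l /(congr1 (size \o val)) /=; rewrite !size_rev !size_mkseq. Qed.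

Lemma word_vertex_adj k : tree_adj (word_vertex k) (word_vertex k.+1).
Proof.
apply/orP; left; apply/tree_childP; exists (a k).
by rewrite /= mkseqS rev_rcons.
Qed.

Definition word_ray : ray (@tree_adj d) := Ray word_vertex_inj word_vertex_adj.

(** Following the letters of [a] by shifts amounts to walking along [word_ray] in
the unshifted configuration: the composed automorphism takes the root and its
neighbour [a k] to the words read off the first [k] and [k.+1] letters. *)
Lemma root_open_walk S k :
  root_open (a k) (foldl (fun S i => shift i S) S (mkseq a k)) =
  S (ray_edge word_ray k).
Proof.
rewrite /root_open foldl_shift; congr S; apply: val_inj.
rewrite edge_image_foldr /=; congr ([fset _; _]%fset); apply: val_inj.
  by rewrite right_mul_foldr //; exact: reduced_rev_mkseq.
have E : [:: a k] ++ rev (mkseq a k) = rev (mkseq a k.+1) by rewrite mkseqS rev_rcons.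
by rewrite right_mul_foldr E //; exact: reduced_rev_mkseq.
Qed.

Lemma payoff_walk (R : realType) (M : R) S n :
  payoff shift (gain root_open M) (mkseq a n) S =
  \sum_(k < n) (S (ray_edge word_ray k))%:R - n%:R * M.
Proof.
elim: n => [|n IHn]; first by rewrite big_ord0 mul0r subr0.
rewrite mkseqS -cats1 payoff_cat IHn /= /gain addr0 root_open_walk.
by rewrite big_ord_recr /= mulrS; ring.
Qed.
End WordRay.
End RightMultiplication.

(** * Density along rays of an invariant percolation *)

Section Percolation.
Variables (R : realType) (d : nat).

(** The index 0 is left out because the average over no edges is 0. *)
Lemma limn_esup_ge (u : nat -> \bar R) (l : \bar R) :
  (forall n, (l <= u n.+1)%E) -> (l <= limn_esup u)%E.
Proof.
move=> lu; rewrite limn_esup_lim; apply: lime_ge; first exact: is_cvg_esups.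
apply: nearW => n; apply: le_trans (lu n) _.
by apply: ereal_sup_ubound; exists n.+1 => /=.
Qed.

Lemma sup_density_ge (M : R) i (S : config (@tree_adj d)) :
  (forall L, above (@shift d) (@root_open d) M L i 0 S) ->
  (M%:E <= sup_density R S)%E.
Proof.
move=> ab; have [a [aS pos]] := above_ray ab.
apply: le_trans (ereal_sup_ubound _); last by exists (word_ray aS).
apply: limn_esup_ge => n; rewrite lee_fin.
have := pos n; rewrite (payoff_walk aS) subr_gt0 => /ltW.
by rewrite mulrC -ler_pdivlMr ?ltr0n // [X in _ -> _ <= X]mulrC.
Qed.

Lemma measurable_shift i : measurable_fun setT (@shift d i).
Proof.
refine (@measurability _ _ _ _ setT (@shift d i) (@cylinders _ (@tree_adj d)) _ _).
  by [].
move=> _ [_ [e [b ->]] <-].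
rewrite setTI; apply: sub_sigma_algebra.
by exists (edge_image (right_aut i) e), b.
Qed.

Lemma measurable_root_open i : measurable_fun setT (@root_open d i).
Proof.
apply: (measurable_fun_bool true); rewrite setTI; apply: sub_sigma_algebra.
by exists (edge_of (root_letter i)), true.
Qed.

(** The event that [above] holds at every length forces a ray of density at least
[M], by [sup_density_ge], so it is null and [stationary_density_le] applies to
the law of [S]. *)
Lemma ae_density_lt (disp : measure_display) (Omega : measurableType disp)
    (P : probability Omega R) (S : {RV P >-> config (@tree_adj d)}) (p M : R) :
  (1 < d)%N -> invariant_law S -> has_marginal S p -> 0 <= M ->
  {ae P, forall w, (sup_density R (S w) < M%:E)%E} ->
  2 * (d%:R - 1) * p <= M * (d%:R + (d%:R - 2) * p).
Proof.
move=> d1 inv marg M0 lt_ae.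
apply: (@stationary_density_le _ _ _ _ (distribution P S)
  (@shift d) (@root_open d)) => //.
- exact: root_open_shift.
- exact: measurable_shift.
- exact: measurable_root_open.
- by move=> i A mA; exact: inv.
- by move=> i; exact: marg.
move=> i; set A := [set x | _].
have mA : measurable A.
  apply: measurable_above_forever; first exact: measurable_shift.
  exact: measurable_root_open.
rewrite -[LHS]/(P (S @^-1` A)); apply: measure_negligible.
  by have := measurable_funPT S measurableT A mA; rewrite setTI.
apply: negligibleS lt_ae => w /= Aw; rewrite /setC /=; apply/negP.
by rewrite -leNgt; exact: sup_density_ge Aw.
Qed.
End Percolation.

Theorem theorem5 (R : realType) (d : nat) (p : R) (hd : (4 <= d)%N)
  (hp0 : 0 < p) (hp1 : p < 1) :
  (p%:E < inf_ess_sup_density (@tree_adj d) p)%E.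
Proof.
have D2 : 4 <= d%:R :> R by rewrite (ler_nat R 4 d).
pose C : R := d%:R + (d%:R - 2) * p.
have C0 : 0 < C by rewrite /C addr_gt0 // ?mulr_gt0 //; lra.
pose Q := 2 * (d%:R - 1) * p / C.
have pQ : p < Q.
  rewrite /Q ltr_pdivlMr // -subr_gt0.
  have -> : 2 * (d%:R - 1) * p - p * C = p * ((d%:R - 2) * (1 - p)) by rewrite /C; ring.
  by apply: mulr_gt0 => //; apply: mulr_gt0; lra.
apply: (@lt_le_trans _ _ Q%:E); first by rewrite lte_fin.
apply/ereal_infP => _ [disp [T [P [S [inv marg ->]]]]].
set f := (X in ess_sup P X); rewrite leNgt; apply/negP => yQ.
(* [ae_density_lt] needs a nonnegative bound, whereas no lower bound on the
   essential supremum is at hand; hence the maximum with 0. *)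
have [M M0 [yM MQ]] : exists2 M : R, 0 <= M & (ess_sup P f < M%:E)%E /\ M < Q.
  case: (ess_sup P f) yQ => [r|//|_].
    rewrite lte_fin => rQ; exists ((Num.max 0 r + Q) / 2).
      have : 0 <= Num.max 0 r by rewrite le_max lexx.
      lra.
    have : Num.max 0 r < Q by rewrite gt_max rQ andbT; lra.
    have : r <= Num.max 0 r by rewrite le_max lexx orbT.
    by rewrite lte_fin; split; lra.
  by exists (Q / 2); [lra | rewrite ltNyr; split => //; lra].
have : 2 * (d%:R - 1) * p <= M * C.
  apply: (ae_density_lt _ inv marg M0); first exact: leq_trans hd.
  apply: filterS (ess_sup_ge P f) => w fw; exact: le_lt_trans fw yM.
by apply/negP; rewrite -ltNge -ltr_pdivlMr.
Qed.
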